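(* The following hold for any $\kappa>0$. (i) $\Phi_{\mathrm{et}}(\cdot,\kappa)$ belongs to $\mathrm{RV}^0$ with index $1$ and $\Phi_{\ln}(\cdot,\kappa)$ belongs to $\mathrm{RV}^0$ with index $0$. (ii) $(\Phi_{\mathrm{et}})^\spadesuit_\kappa(t)\to-\infty$ and $(\Phi_{\ln})^\spadesuit_\kappa(t)\to-\infty$ as $t\to0_+$. (iii) The convergence rate afforded by $\Phi_{\mathrm{et}}$ is almost linear in the following sense: for any $r>0$, as $s\to+\infty$, $$\sqrt{((\Phi_{\mathrm{et}})^\spadesuit_\kappa)^{-1}(-s)}=o(s^{-r}),\qquad e^{-rs}=o\Big(\sqrt{((\Phi_{\mathrm{et}})^\spadesuit_\kappa)^{-1}(-s)}\Big).$$ (iv) The convergence rate afforded by $\Phi_{\ln}$ is logarithmic in the following sense: there exist $\eta_1>0$, $\eta_2>0$ and $N$ such that for $s\ge N$, $$\eta_1\Big(\frac{1}{\ln(s)}\Big)\le\sqrt{((\Phi_{\ln})^\spadesuit_\kappa)^{-1}(-s)}\le\eta_2\Big(\frac{1}{\ln(s)}\Big).$$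
   Context: The exponential cone is $K_{\exp}:=\{(x,y,z)\in\mathbb{R}^3: y>0,\ z\ge ye^{x/y}\}\cup\{(x,y,z): x\le0,\ z\ge0,\ y=0\}$. Let $\mathcal{V}_1:=\{(x,0,z): x,z\in\mathbb{R}\}$, $\mathcal{V}_2:=\{(x,y,0): x,y\in\mathbb{R}\}$, and $d_i(p):=\max\{\mathrm{dist}(p,K_{\exp}),\mathrm{dist}(p,\mathcal{V}_i)\}$ for $p\in\mathbb{R}^3$, $i=1,2$. Define $$\mathfrak{g}_{-\infty}(t):=\begin{cases}0&t=0,\\-t\ln(t)&t\in(0,1/e^2],\\t+\frac{1}{e^2}&t>1/e^2,\end{cases}\qquad\mathfrak{g}_\infty(t):=\begin{cases}0&t=0,\\-\frac{1}{\ln(t)}&0<t\le\frac{1}{e^2},\\\frac14+\frac14e^2t&t>\frac{1}{e^2}.\end{cases}$$ It is known that there are positive monotone nondecreasing functions $\rho_1,\rho_2$ such that for every $b>0$ and every $p\in\mathbb{R}^3$ with $\|p\|\le b$, $\mathrm{dist}(p,K_{\exp}\cap\mathcal{V}_1)\le\rho_1(b)\,\mathfrak{g}_{-\infty}(d_1(p))$ and $\mathrm{dist}(p,K_{\exp}\cap\mathcal{V}_2)\le\rho_2(b)\,\mathfrak{g}_\infty(d_2(p))$. Fix such $\rho_1,\rho_2$ and set $$\Phi_{\mathrm{et}}(a,b):=\rho_1(b)\,\mathfrak{g}_{-\infty}(a),\qquad\Phi_{\ln}(a,b):=\rho_2(b)\,\mathfrak{g}_\infty(a).$$ For a strictly increasing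 $f:[0,\infty)\to[0,\infty)$, $f^-(s):=\inf\{t\ge0: f(t)\ge s\}$ for $0\le s<\sup f$. For $\Phi\in\{\Phi_{\mathrm{et}},\Phi_{\ln}\}$ and $\kappa>0$, $\phi_{\kappa,\Phi}(t):=(\Phi(\sqrt t,\kappa))^2$, $t\ge0$, and $\Phi^\spadesuit_\kappa(t):=\int_\delta^t\frac{1}{\phi^-_{\kappa,\Phi}(s)}\,ds$ for $t\in(0,\sup\phi_{\kappa,\Phi})$, with $\delta\in(0,\sup\phi_{\kappa,\Phi})$ some fixed number; it is strictly increasing and continuous, with inverse $(\Phi^\spadesuit_\kappa)^{-1}$ defined on its range. A measurable $f$ that is positive on some interval $(0,a]$, $a>0$, belongs to $\mathrm{RV}^0$ with index $\rho$ if $\lim_{x\to0_+}f(\lambda x)/f(x)=\lambda^\rho$ for all $\lambda>0$. ''$f(s)=o(g(s))$ as $s\to+\infty$'' means $\lim_{s\to+\infty}f(s)/g(s)=0$. *)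

(* Defs.v *)
From mathcomp Require Import all_boot all_order all_algebra.
From mathcomp Require Import all_classical all_reals all_analysis.

Set Implicit Arguments.
Unset Strict Implicit.
Unset Printing Implicit Defensive.

Import Order.TTheory GRing.Theory Num.Theory.
Import numFieldNormedType.Exports.

Local Open Scope classical_set_scope.
Local Open Scope ring_scope.

(** * The exponential cone and Euclidean distances in R^3 *)

(* The norm that the library attaches to ['rV[R]_n] is the max norm, so the
   Euclidean norm and the associated distance to a set are defined here. *)
Definition enorm (R : realType) (n : nat) (p : 'rV[R]_n) : R :=
  Num.sqrt (\sum_(i < n) p 0 i ^+ 2).

Definition edist_set (R : realType) (n : nat) (p : 'rV[R]_n)
    (S : set 'rV[R]_n) : R :=
  inf [set enorm (p - q) | q in S].

Definition Kexp (R : realType) : set 'rV[R]_3 :=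
  [set p : 'rV[R]_3 | let x := p 0 0 in let y := p 0 1 in let z := p 0 2 in
     (0 < y /\ y * expR (x / y) <= z) \/ [/\ x <= 0, 0 <= z & y = 0]].

Definition V1 (R : realType) : set 'rV[R]_3 := [set p : 'rV[R]_3 | p 0 1 = 0].

Definition V2 (R : realType) : set 'rV[R]_3 := [set p : 'rV[R]_3 | p 0 2 = 0].

Definition dmax (R : realType) (V : set 'rV[R]_3) (p : 'rV[R]_3) : R :=
  Num.max (edist_set p (@Kexp R)) (edist_set p V).

(** * The residual functions (only their values on [0, +oo[ are relevant) *)

Definition g_minfty (R : realType) (t : R) : R :=
  if t == 0 then 0
  else if t <= (expR 2)^-1 then - t * ln t
  else t + (expR 2)^-1.

Definition g_infty (R : realType) (t : R) : R :=
  if t == 0 then 0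
  else if t <= (expR 2)^-1 then - (ln t)^-1
  else 4^-1 + 4^-1 * expR 2 * t.

Definition error_bound (R : realType) (V : set 'rV[R]_3) (g rho : R -> R) :=
  forall (b : R) (p : 'rV[R]_3), 0 < b -> enorm p <= b ->
    edist_set p (@Kexp R `&` V) <= rho b * g (dmax V p).

Definition Phi_et (R : realType) (rho1 : R -> R) (a b : R) : R :=
  rho1 b * g_minfty a.

Definition Phi_ln (R : realType) (rho2 : R -> R) (a b : R) : R :=
  rho2 b * g_infty a.

(** * The construction of Phi^spadesuit *)

Definition geninv (R : realType) (f : R -> R) (s : R) : R :=
  inf [set t | 0 <= t /\ s <= f t].

Definition phi (R : realType) (kappa : R) (Phi : R -> R -> R) (t : R) : R :=
  (Phi (Num.sqrt t) kappa) ^+ 2.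

(* The open interval (0, sup phi); the supremum of phi over [0, +oo[ is taken
   in the extended reals, since it may be infinite. *)
Definition phi_dom (R : realType) (kappa : R) (Phi : R -> R -> R) : set R :=
  [set t | 0 < t /\
     (t%:E < ereal_sup [set (phi kappa Phi u)%:E | u in `[0%R, +oo[])%E].

(* The integral of f from a to b, with the usual sign convention if b < a. *)
Definition oriented_int (R : realType) (a b : R) (f : R -> R) : R :=
  if a <= b then \int[@lebesgue_measure R]_(x in `[a, b]) f x
  else - \int[@lebesgue_measure R]_(x in `[b, a]) f x.

Definition spade (R : realType) (kappa : R) (Phi : R -> R -> R)
    (delta t : R) : R :=
  oriented_int delta t (fun s => (geninv (phi kappa Phi) s)^-1).

(* The inverse of the restriction of [spade] to (0, sup phi), meaningful on
   the range of this restriction. *)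
Definition spade_inv (R : realType) (kappa : R) (Phi : R -> R -> R)
    (delta : R) : R -> R :=
  'pinv_(fun=> 0) (phi_dom kappa Phi) (spade kappa Phi delta).

(** * Regular variation at 0 and asymptotic comparison at +oo *)

Definition RV0 (R : realType) (f : R -> R) (rho : R) : Prop :=
  [/\ measurable_fun (`[0, +oo[ : set R) f,
      (exists2 a : R, 0 < a & forall x, 0 < x <= a -> 0 < f x) &
      forall lambda : R, 0 < lambda ->
        f (lambda * x) / f x @[x --> 0^'+] --> lambda `^ rho].

Definition little_o_pinfty (R : realType) (f g : R -> R) : Prop :=
  f s / g s @[s --> +oo] --> 0.

(* Main.v *)
Require Import Defs.
From mathcomp Require Import all_boot all_order all_algebra.
From mathcomp Require Import all_classical all_reals all_analysis.
From mathcomp Require Import measurable_realfun ring lra.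

Set Implicit Arguments.
Unset Strict Implicit.
Unset Printing Implicit Defensive.

Import Order.TTheory GRing.Theory Num.Theory.
Import numFieldNormedType.Exports.

Local Open Scope classical_set_scope.
Local Open Scope ring_scope.

(** Write [C] for [rho1 kappa] or [rho2 kappa], [g] for the corresponding
    residual function, [phi t = (C * g (sqrt t)) ^+ 2], and [S] for the
    function [spade], whose derivative is [1 / phi^-].

    The inverse of [phi] has no closed form for [g_minfty], but it need not be
    computed: [phi^- (phi u) = u], so [S] becomes explicit along the curve
    [T L = phi (expR (- (2 * L)))], [2 <= L], which runs down to [0] as [L]
    tends to infinity. There [1 / phi^- (T L) = expR (2 * L)], hence
    [(S \o T)' L = expR (2 * L) * T' L], and by the formulas for [g] near [0]

      - for [g_minfty], [sqrt (T L) = C * L * expR (- L)] and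
        [(S \o T)' L = - 2 * C ^+ 2 * (L ^+ 2 - L)], so that [- S (T L)] grows
        like [L ^+ 3] (lemma [spade_et_bounds]);
      - for [g_infty], [sqrt (T L) = C / L] and
        [(S \o T)' L = - 2 * C ^+ 2 * expR (2 * L) / L ^+ 3], so that
        [- S (T L)] lies between multiples of [expR L] and of
        [expR (2 * L)] up to a constant (lemma [spade_ln_bounds]).

    In both cases [S] is unbounded below at [0], and it is monotone, which
    gives (ii). Since [S] is injective, [spade_inv (- s) = T L] as soon as
    [s = - S (T L)], and by the intermediate value theorem every large [s] has
    this form with [L] large. Asymptotics in [s] thus become asymptotics in [L]
    (lemma [near_spade_inv]): in (iii), [L * expR (- L)] is compared with powers
    and exponentials of a quantity of order [L ^+ 3]; in (iv), [1 / L] is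
    compared with the inverse of the logarithm of a quantity between [expR L]
    and [expR (2 * L)]. Part (i) is a direct computation with logarithms. *)

(** * Residual functions and their generalized inverses *)

(** Strict monotonicity makes [geninv f] a continuous left inverse of [f],
    small values near [0] make it positive on the positive reals, and
    unboundedness ensures that it is the infimum of a nonempty set. *)
Definition residual (R : realType) (f : R -> R) : Prop :=
  [/\ f 0 = 0,
      forall x y, 0 <= x -> x < y -> f x < f y,
      forall e, 0 < e -> exists2 w, 0 < w & f w <= e &
      forall M, exists2 w, 0 <= w & M <= f w].

Lemma residual_ge0 (R : realType) (f : R -> R) (x : R) :
  residual f -> 0 <= x -> 0 <= f x.
Proof.
case=> f0 fi _ _; rewrite le_eqVlt => /predU1P[<-|x0]; first by rewrite f0.
by rewrite -f0 ltW// fi.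
Qed.

Lemma residualZ (R : realType) (f : R -> R) (c : R) :
  0 < c -> residual f -> residual (fun x => c * f x).
Proof.
move=> c0 [f0 fi fs fu]; split.
- by rewrite f0 mulr0.
- by move=> x y x0 xy; rewrite ltr_pM2l// fi.
- move=> e e0; have [w w0 fw] := fs _ (divr_gt0 e0 c0).
  by exists w => //; rewrite mulrC -ler_pdivlMr.
- move=> M; have [w w0 fw] := fu (M / c).
  by exists w => //; rewrite mulrC -ler_pdivrMr.
Qed.

Lemma residual_phi (R : realType) (kappa : R) (Phi : R -> R -> R) :
  residual (Phi ^~ kappa) -> residual (phi kappa Phi).
Proof.
move=> resf; have [f0 fi fs fu] := resf; rewrite /phi; split.
- by rewrite sqrtr0 f0 expr0n.
- move=> x y x0 xy; have y0 := le_lt_trans x0 xy.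
  have xy' : Num.sqrt x < Num.sqrt y by rewrite ltr_sqrt.
  rewrite ltrXn2r ?fi//.
  exact: (residual_ge0 resf).
- move=> e e0; have e'0 : 0 < Num.sqrt e by rewrite sqrtr_gt0.
  have [w w0 fw] := fs _ e'0.
  exists (w ^+ 2); first by rewrite exprn_gt0.
  rewrite sqrtr_sqr gtr0_norm// -[leRHS](sqr_sqrtr (ltW e0)) lerXn2r//.
    by rewrite nnegrE (residual_ge0 resf)// ltW.
  by rewrite nnegrE ltW.
- move=> M; have [w w0 fw] := fu (`|M| + 1).
  exists (w ^+ 2); first by rewrite exprn_ge0.
  rewrite sqrtr_sqr ger0_norm//.
  have M0 : 0 <= `|M| by [].
  have := ler_norm M.
  move: M0 fw; set m := `|M|; set u := Phi w kappa; nra.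
Qed.

Lemma geninv_lbound (R : realType) (f : R -> R) (s : R) :
  lbound [set t | 0 <= t /\ s <= f t] 0.
Proof. by move=> t []. Qed.

Lemma geninv_le (R : realType) (f : R -> R) (s t : R) :
  0 <= t -> s <= f t -> geninv f s <= t.
Proof.
by move=> t0 st; apply: ge_inf; [exists 0; exact: geninv_lbound|].
Qed.

Lemma geninvK (R : realType) (f : R -> R) (t : R) :
  residual f -> 0 <= t -> geninv f (f t) = t.
Proof.
case=> f0 fi _ _ t0; apply/eqP; rewrite eq_le geninv_le//=.
apply: lb_le_inf; first by exists t.
by move=> u [u0]; rewrite leNgt; apply: contraNle => /(fi _ _ u0).
Qed.

Lemma le_geninv (R : realType) (f : R -> R) (s s' : R) :
  residual f -> s <= s' -> geninv f s <= geninv f s'.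
Proof.
case=> _ _ _ fu ss'; apply: lb_le_inf.
  by have [w w0 fw] := fu s'; exists w.
by move=> t [t0 s't]; apply: geninv_le => //; exact: le_trans s't.
Qed.

Lemma geninv_gt0 (R : realType) (f : R -> R) (s : R) :
  residual f -> 0 < s -> 0 < geninv f s.
Proof.
move=> resf s0; have [_ _ fs _] := resf; have [w w0 fw] := fs _ s0.
by rewrite (lt_le_trans w0)// -[leLHS](geninvK resf (ltW w0)) le_geninv.
Qed.

(** A monotone left inverse of a strictly increasing function has no jumps,
    because a jump would skip values that it has to take. Here this is made
    quantitative around [w = geninv f s]: the neighbourhood of [s] on which
    [geninv f] stays within [e] of [w] is [[f t2, f t1]], with [t1] and [t2]
    at distance at most [e] from [w]. *)
Lemma continuous_geninv (R : realType) (f : R -> R) (s : R) :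
  residual f -> 0 < s -> {for s, continuous (geninv f)}.
Proof.
move=> resf s0; have [f0 fi _ fu] := resf.
have w0 := geninv_gt0 resf s0; set w := geninv f s in w0 *.
apply/cvgrPdist_le => /= e e0.
have [t1 t1w st1] : exists2 t1, 0 <= t1 <= w + e & s < f t1.
  have : has_inf [set t | 0 <= t /\ s <= f t].
    split; last by exists 0; exact: geninv_lbound.
    by have [v v0 fv] := fu s; exists v.
  have e20 : 0 < e / 2 by rewrite divr_gt0.
  move=> /(inf_adherent e20)[t [t0 st]]; rewrite -/(geninv f s) -/w => tw.
  (* Some t < w + e / 2 has s <= f t; strict monotonicity from t to w + e makes
     the inequality strict. *)
  exists (w + e); first by rewrite lexx andbT addr_ge0// ltW.
  by apply: le_lt_trans st (fi _ _ t0 _); apply: lt_trans tw _; lra.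
have [t2 t2w st2] : exists2 t2, 0 <= t2 /\ w - e <= t2 & f t2 < s.
  exists (Num.max 0 (w - e)); first by rewrite !le_max !lexx orbT.
  rewrite ltNge; apply/negP => sf.
  have : w <= Num.max 0 (w - e) by apply: geninv_le => //; rewrite le_max lexx.
  by rewrite le_max leNgt w0/=; lra.
near=> x.
have xt1 : x <= f t1 by near: x; exact: (lt_le_nbhsl st1).
have xt2 : f t2 <= x by near: x; exact: (lt_le_nbhsr st2).
have /andP[t10 t1e] := t1w.
have u := geninv_le t10 xt1.
have l : t2 <= geninv f x by rewrite -[leLHS](geninvK resf t2w.1) le_geninv.
by rewrite ler_distlC; apply/andP; split; [exact: le_trans t2w.2 l|exact: le_trans u _].
Unshelve. all: by end_near. Qed.

Lemma phi_domE (R : realType) (kappa : R) (Phi : R -> R -> R) (t : R) :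
  residual (phi kappa Phi) -> phi_dom kappa Phi t <-> 0 < t.
Proof.
case=> f0 fi _ fu; split=> [[]//|t0]; split => //.
have [w w0 fw] := fu (t + 1).
apply: (@lt_le_trans _ _ (phi kappa Phi w)%:E).
  by rewrite lte_fin; apply: lt_le_trans fw; rewrite ltrDl.
by apply: ereal_sup_ubound; exists w => //=; rewrite in_itv/= w0.
Qed.

(** * Calculus on the real line *)

(** The fundamental theorem of calculus is applied to the integral from a base
    point [a] below both [delta] and [t], which covers the two orientations at
    once: the oriented integral differs from it by a constant. *)
Lemma is_derive_oriented_int (R : realType) (F : R -> R) (delta t : R) :
  (forall x, 0 < x -> {for x, continuous F}) -> 0 < delta -> 0 < t ->
  is_derive t 1 (fun x => oriented_int delta x F) (F t).
Proof.
move=> cF d0 t0.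
pose a := Num.min delta t / 2; pose u := Num.max delta t + 1.
have m0 : 0 < Num.min delta t by rewrite lt_min d0.
have a0 : 0 < a by rewrite divr_gt0.
have am : a < Num.min delta t by rewrite /a; lra.
have /andP[ad at'] : (a < delta) && (a < t) by rewrite -lt_min.
have /andP[du tu] : (delta < u) && (t < u).
  by rewrite -gt_max /u ltrDl.
have iF : (@lebesgue_measure R).-integrable `[a, u] (EFin \o F).
  apply: continuous_compact_integrable; first exact: segment_compact.
  apply: continuous_in_subspaceT => x; rewrite inE/= in_itv/= => /andP[ax _].
  exact/cF/(lt_le_trans a0).
have split_int b c : a < b -> b <= c -> c < u ->
    \int[@lebesgue_measure R]_(x in `[b, c]) F x =
    \int[@lebesgue_measure R]_(x in `[a, c]) F x -
    \int[@lebesgue_measure R]_(x in `[a, b]) F x.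
  move=> ab bc cu.
  have iac : (@lebesgue_measure R).-integrable `[a, c] (EFin \o F).
    apply: integrableS iF => //; apply: subset_itvl; rewrite bnd_simp; exact: ltW.
  rewrite (Rintegral_itvB iac) ?bnd_simp ?(ltW ab)//.
  rewrite Rintegral_itv_obnd_cbnd//; apply: integrableS iac => //.
  by apply: subset_itvr; rewrite bnd_simp ltW.
have [dF F'] := continuous_FTC1_closed tu iF at' (cF _ t0).
apply: (@near_eq_is_derive _ _ _ (fun x =>
    \int[@lebesgue_measure R]_(y in `[a, x]) F y -
    \int[@lebesgue_measure R]_(y in `[a, delta]) F y)).
  near=> x.
  have ax : a < x by near: x; exact: (lt_nbhsr at').
  have xu : x < u by near: x; exact: (lt_nbhsl tu).
  rewrite /oriented_int; case: ifPn => [dx|]; first by rewrite (split_int delta x).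
  by rewrite -ltNge => /ltW xd; rewrite (split_int x delta)// opprB.
rewrite -[X in is_derive _ _ _ X]subr0.
apply: (@is_deriveB _ _ _ _ (cst _)).
by apply: DeriveDef; rewrite -?derive1E.
Unshelve. all: by end_near. Qed.

(** The mean value theorem for [g - f]. *)
Lemma derive_increment_le (R : realType) (f g df dg : R -> R) (a b : R) :
  a <= b -> (forall x, a <= x <= b -> is_derive x 1 f (df x)) ->
  (forall x, a <= x <= b -> is_derive x 1 g (dg x)) ->
  (forall x, a <= x <= b -> df x <= dg x) ->
  f b - f a <= g b - g a.
Proof.
move=> ab fdf gdg dfg.
have dh x : x \in `[a, b] -> is_derive x 1 (g - f) (dg x - df x).
  by rewrite in_itv/= => xab; have := fdf _ xab; have := gdg _ xab; exact: is_deriveB.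
have dh' x : x \in `]a, b[ -> is_derive x 1 (g - f) (dg x - df x).
  by move/subset_itv_oo_cc; exact: dh.
have ch : {within `[a, b], continuous (g - f)}.
  by apply: derivable_within_continuous => x /dh[].
have [c cab] := MVT_segment ab dh' ch.
rewrite !fctE => h; have : 0 <= (dg c - df c) * (b - a).
  by rewrite mulr_ge0 ?subr_ge0// dfg//; rewrite in_itv in cab.
by rewrite -h; lra.
Qed.

Lemma is_derive_continuous (R : realType) (f : R -> R) (x df : R) :
  is_derive x 1 f df -> {for x, continuous f}.
Proof. by case=> /derivable1_diffP/differentiable_continuous. Qed.

(** By the intermediate value theorem, a continuous [H] that tends to infinity
    takes every large value at arbitrarily large points, so what holds
    eventually along [H] holds eventually. *)
Lemma near_reparam (R : realType) (H : R -> R) (a : R) (P : R -> Prop) :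
  (forall x, a <= x -> {for x, continuous H}) ->
  H x @[x --> +oo] --> +oo ->
  (\forall x \near +oo, P (H x)) -> \forall s \near +oo, P s.
Proof.
move=> cH Hy [M [_ MP]].
pose L1 := Num.max M a + 1.
have L1M : M < L1 by rewrite /L1 ltr_pwDr// le_max lexx.
have L1a : a <= L1 by rewrite /L1 ler_wpDr// le_max lexx orbT.
near=> s.
have sH : H L1 <= s by near: s; apply: nbhs_pinfty_ge; rewrite num_real.
have [L2 [L12 sL2]] : exists L2, L1 <= L2 /\ s <= H L2.
  near (pinfty_nbhs R) => L2; exists L2; split.
    by near: L2; apply: nbhs_pinfty_ge; rewrite num_real.
  by near: L2; move/cvgryPge : Hy; exact.
have cH12 : {within `[L1, L2], continuous H}.
  apply: continuous_in_subspaceT => x; rewrite inE/= in_itv/= => /andP[L1x _].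
  by apply: cH; exact: le_trans L1x.
have sH12 : Num.min (H L1) (H L2) <= s <= Num.max (H L1) (H L2).
  by rewrite ge_min sH/= le_max sL2 orbT.
have [c] := IVT L12 cH12 sH12.
rewrite in_itv/= => /andP[L1c _] <-; apply: MP; exact: lt_le_trans L1c.
Unshelve. all: by end_near. Qed.

(** * The function [spade] and its inverse *)

Lemma is_derive_spade (R : realType) (kappa : R) (Phi : R -> R -> R)
    (delta t : R) :
  residual (phi kappa Phi) -> 0 < delta -> 0 < t ->
  is_derive t 1 (spade kappa Phi delta) (geninv (phi kappa Phi) t)^-1.
Proof.
move=> resf; apply: is_derive_oriented_int => x x0.
apply: continuousV; last exact: continuous_geninv.
by rewrite gt_eqF// geninv_gt0.
Qed.

Lemma spade_lt (R : realType) (kappa : R) (Phi : R -> R -> R)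
    (delta x y : R) :
  residual (phi kappa Phi) -> 0 < delta -> 0 < x -> x < y ->
  spade kappa Phi delta x < spade kappa Phi delta y.
Proof.
move=> resf d0 x0 xy.
have dS z : x <= z -> is_derive z 1 (spade kappa Phi delta)
    (geninv (phi kappa Phi) z)^-1.
  by move=> xz; apply: is_derive_spade => //; exact: lt_le_trans xz.
have dS' z : z \in `]x, y[ -> is_derive z 1 (spade kappa Phi delta)
    (geninv (phi kappa Phi) z)^-1.
  by rewrite in_itv/= => /andP[/ltW xz _]; exact: dS.
have cS : {within `[x, y], continuous (spade kappa Phi delta)}.
  apply: derivable_within_continuous => z; rewrite in_itv/= => /andP[xz _].
  by have [] := dS _ xz.
have [c] := MVT xy dS' cS.
rewrite in_itv/= => /andP[xc _] Sxy; rewrite -subr_gt0 Sxy.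
by rewrite mulr_gt0 ?subr_gt0// invr_gt0 geninv_gt0// (lt_trans x0).
Qed.

Lemma spadeK (R : realType) (kappa : R) (Phi : R -> R -> R) (delta t : R) :
  residual (phi kappa Phi) -> 0 < delta -> 0 < t ->
  spade_inv kappa Phi delta (spade kappa Phi delta t) = t.
Proof.
move=> resf d0 t0; rewrite /spade_inv pinvKV//; last first.
  by rewrite inE phi_domE.
move=> x y; rewrite !inE !phi_domE// => x0 y0 Sxy.
by case: (ltgtP x y) => // [/(spade_lt resf d0 x0)|/(spade_lt resf d0 y0)];
  rewrite Sxy ltxx.
Qed.

(** The change of variable on which everything rests: along points
    [T L = phi (expR (- (2 * L)))] the derivative of [spade] is [expR (2 * L)],
    whatever [phi] is. *)
Lemma is_derive_spade_curve (R : realType) (kappa : R) (Phi : R -> R -> R)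
    (delta L dT : R) (T : R -> R) :
  residual (phi kappa Phi) -> 0 < delta ->
  T L = phi kappa Phi (expR (- (2 * L))) ->
  is_derive L 1 T dT ->
  is_derive L 1 (spade kappa Phi delta \o T) (expR (2 * L) * dT).
Proof.
move=> resf d0 TL dTL; apply: is_derive1_comp.
have -> : expR (2 * L) = (geninv (phi kappa Phi) (T L))^-1.
  by rewrite TL geninvK ?expR_ge0// expRN invrK.
apply: is_derive_spade => //; rewrite TL.
have [f0 fi _ _] := resf; by rewrite -f0 fi// expR_gt0.
Qed.

(** As [spade] is increasing, it tends to [-oo] at [0] as soon as it is
    unbounded below along some positive curve [T]. *)
Lemma spade_cvgNy (R : realType) (kappa : R) (Phi : R -> R -> R)
    (delta : R) (T : R -> R) :
  residual (phi kappa Phi) -> 0 < delta ->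
  (\forall L \near +oo, 0 < T L) ->
  - spade kappa Phi delta (T L) @[L --> +oo] --> +oo ->
  spade kappa Phi delta t @[t --> 0^'+] --> -oo.
Proof.
move=> resf d0 T0 HT; apply/cvgrNyPle => M.
near (pinfty_nbhs R) => L.
have TL0 : 0 < T L by near: L.
have STL : spade kappa Phi delta (T L) <= M.
  by rewrite -lerN2; near: L; move/cvgryPge : HT; exact.
near=> t; apply/ltW/lt_le_trans/STL/spade_lt => //.
Unshelve. all: by end_near. Qed.

(** Reduces the asymptotics of [spade_inv] at [- s], for large [s], to those of
    the curve [T]: substitute [s = - spade (T L)], for which
    [spade_inv (- s) = T L]. *)
Lemma near_spade_inv (R : realType) (kappa : R) (Phi : R -> R -> R)
    (delta : R) (T dT : R -> R) (P : R -> R -> Prop) :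
  residual (phi kappa Phi) -> 0 < delta ->
  (forall L : R, 2 <= L -> T L = phi kappa Phi (expR (- (2 * L)))) ->
  (forall L : R, 2 <= L -> is_derive L 1 T (dT L)) ->
  - spade kappa Phi delta (T L) @[L --> +oo] --> +oo ->
  (\forall L \near +oo, P (- spade kappa Phi delta (T L)) (T L)) ->
  \forall s \near +oo, P s (spade_inv kappa Phi delta (- s)).
Proof.
move=> resf d0 TE dTE HT PT.
apply: (near_reparam (a := 2) _ HT) => [L L2|].
  apply: continuousN; apply: is_derive_continuous.
  exact: is_derive_spade_curve resf d0 (TE _ L2) (dTE _ L2).
near=> L; rewrite opprK spadeK//; first by near: L.
have L2 : 2 <= L by near: L; apply: nbhs_pinfty_ge; rewrite num_real.
by have [f0 fi _ _] := resf; rewrite TE// -f0 fi// expR_gt0.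
Unshelve. all: by end_near. Qed.

(** Bounds on the derivative of [- spade \o T] integrate to bounds on
    [- spade \o T] itself, up to a constant that accounts for the values at
    [2]. *)
Lemma spade_curve_bounds (R : realType) (kappa : R) (Phi : R -> R -> R)
    (delta : R) (T dT l dl u du : R -> R) :
  residual (phi kappa Phi) -> 0 < delta ->
  (forall L : R, 2 <= L -> T L = phi kappa Phi (expR (- (2 * L)))) ->
  (forall L : R, 2 <= L -> is_derive L 1 T (dT L)) ->
  (forall L : R, 2 <= L -> is_derive L 1 l (dl L)) ->
  (forall L : R, 2 <= L -> is_derive L 1 u (du L)) ->
  (forall L : R, 2 <= L -> dl L <= - (expR (2 * L) * dT L) <= du L) ->
  exists2 K, 0 < K & forall L : R, 2 <= L ->
    l L - K <= - spade kappa Phi delta (T L) <= u L + K.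
Proof.
move=> resf d0 TE dTE dlE duE dlu.
pose H L := - spade kappa Phi delta (T L).
have dH (L : R) : 2 <= L -> is_derive L 1 H (- (expR (2 * L) * dT L)).
  by move=> L2; apply: is_deriveN; exact: is_derive_spade_curve resf d0 (TE _ L2) (dTE _ L2).
exists (`|H 2| + `|l 2| + `|u 2| + 1); first by rewrite ltr_wpDl// !addr_ge0.
move=> L L2.
have lH : l L - l 2 <= H L - H 2.
  apply: (derive_increment_le L2) => [x|x|x] /andP[x2 _].
  - exact: dlE.
  - exact: dH.
  - by have /andP[] := dlu _ x2.
have uH : H L - H 2 <= u L - u 2.
  apply: (derive_increment_le L2) => [x|x|x] /andP[x2 _].
  - exact: dH.
  - exact: duE.
  - by have /andP[] := dlu _ x2.
rewrite -/(H L).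
have ler_Nnorm (x : R) : - x <= `|x| by rewrite -normrN ler_norm.
have HN := ler_Nnorm (H 2); have HP := ler_norm (H 2).
have lP := ler_norm (l 2); have uN := ler_Nnorm (u 2).
have H0 := normr_ge0 (H 2); have l0 := normr_ge0 (l 2); have u0 := normr_ge0 (u 2).
move: (H L) (H 2) lH uH HN HP H0 => h h2 *.
by apply/andP; split; lra.
Qed.

(** * The residual functions [g_minfty] and [g_infty] *)

Lemma sqrtr_expR2 (R : realType) (x : R) : Num.sqrt (expR (2 * x)) = expR x.
Proof. by rewrite expRM_natl sqrtr_sqr ger0_norm// expR_ge0. Qed.

Lemma phi_expR (R : realType) (kappa : R) (Phi : R -> R -> R) (L : R) :
  phi kappa Phi (expR (- (2 * L))) = Phi (expR (- L)) kappa ^+ 2.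
Proof. by rewrite /phi -mulrN sqrtr_expR2. Qed.

Lemma expRN_le (R : realType) (L : R) : 2 <= L -> expR (- L) <= (expR 2)^-1.
Proof. by move=> L2; rewrite -expRN ler_expR lerN2. Qed.

Lemma g_minfty_expRN (R : realType) (L : R) :
  2 <= L -> g_minfty (expR (- L)) = L * expR (- L).
Proof.
by move=> L2; rewrite /g_minfty expR_eq0 expRN_le// expRK mulrNN mulrC.
Qed.

Lemma g_infty_expRN (R : realType) (L : R) :
  2 <= L -> g_infty (expR (- L)) = L^-1.
Proof.
by move=> L2; rewrite /g_infty expR_eq0 expRN_le// expRK invrN opprK.
Qed.

(** Points of the first branch of [g_minfty] and [g_infty] are best written as
    [expR (- L)], where the two functions are [L * expR (- L)] and [1 / L]. *)
Lemma expRN_ln (R : realType) (x : R) : 0 < x <= (expR 2)^-1 ->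
  exists2 L, 2 <= L & x = expR (- L).
Proof.
move=> /andP[x0 xe]; exists (- ln x); last by rewrite opprK lnK.
by rewrite lerNr -(expRK (-2)) ler_ln ?posrE ?expR_gt0// expRN.
Qed.

Lemma residual_g_minfty (R : realType) : residual (@g_minfty R).
Proof.
have e0 : 0 < (expR 2)^-1 :> R by rewrite invr_gt0 expR_gt0.
split.
- by rewrite /g_minfty eqxx.
- move=> x y; rewrite le_eqVlt => /predU1P[<- y0|x0 xy].
    rewrite {1}/g_minfty eqxx; have [ye|ye] := leP y (expR 2)^-1.
      have [|L L2 ->] := @expRN_ln _ y; first by rewrite y0.
      by rewrite g_minfty_expRN// mulr_gt0 ?expR_gt0//; lra.
    by rewrite /g_minfty gt_eqF// leNgt ye/= addr_gt0.
  have y0 := lt_trans x0 xy.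
  have [ye|ye] := leP y (expR 2)^-1.
    have [|L L2 yL] := @expRN_ln _ y; first by rewrite y0.
    have [|K K2 xK] := @expRN_ln _ x.
      by rewrite x0 (le_trans _ ye)// ltW.
    rewrite xK yL !g_minfty_expRN//.
    have LK : L < K by move: xy; rewrite xK yL ltr_expR ltrN2.
    (* With h := K - L > 0, the claim K < L * expR h follows from 1 + h <= expR h
       and 1 < L. *)
    have -> : expR (- L) = expR (- K) * expR (K - L).
      by rewrite -expRD; congr expR; ring.
    have h1 := expR_ge1Dx (K - L).
    rewrite mulrCA mulrC ltr_pM2l ?expR_gt0//.
    by move: LK L2 h1; set e := expR (K - L); nra.
  rewrite [ltRHS]/g_minfty (gt_eqF y0) leNgt ye/=.
  have [xe|xe] := leP x (expR 2)^-1.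
    have [|K K2 xK] := @expRN_ln _ x; first by rewrite x0.
    rewrite xK g_minfty_expRN//.
    (* The value at the junction point separates the two branches. *)
    apply: (@le_lt_trans _ _ (2 * (expR 2)^-1)); last by lra.
    rewrite -expRN; have -> : - (2:R) = - K + (K - 2) by lra.
    rewrite expRD mulrCA mulrC ler_pM2l ?expR_gt0//.
    by have := expR_ge1Dx (K - 2); lra.
  by rewrite /g_minfty (gt_eqF x0) leNgt xe/= ltrD2r.
- (* (L / 2) ^+ 2 <= expR L bounds L * expR (- L) by 4 / L, which is at most e
     for the chosen L. *)
  move=> e ep; exists (expR (- (2 + 4 / e))); first exact: expR_gt0.
  have q0 : 0 < 4 / e by rewrite divr_gt0.
  rewrite g_minfty_expRN; last by rewrite lerDl ltW.
  set L := 2 + 4 / e.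
  have L0 : 0 < L by rewrite addr_gt0.
  have eL : (L / 2) ^+ 2 <= expR L.
    have -> : expR L = expR (L / 2) ^+ 2.
      by rewrite -expRM_natl; congr expR; field.
    have L20 : 0 <= L / 2 by rewrite divr_ge0// ltW.
    rewrite lerXn2r ?nnegrE ?expR_ge0//.
    by have := expR_ge1Dx (L / 2); lra.
  rewrite expRN ler_pdivrMr ?expR_gt0//; apply: le_trans (ler_wpM2l (ltW ep) eL).
  have -> : e * (L / 2) ^+ 2 = L * (e * L / 4) by field.
  rewrite ler_peMr ?ltW//.
  have -> : e * L = 2 * e + 4 by rewrite /L; field; rewrite gt_eqF.
  by lra.
- move=> M; exists (`|M| + (expR 2)^-1 + 1).
    by rewrite !addr_ge0// ltW.
  rewrite /g_minfty gt_eqF ?ltr_wpDl ?addr_ge0 ?(ltW e0)//.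
  have -> : `|M| + (expR 2)^-1 + 1 <= (expR 2)^-1 = false.
    by apply/negbTE; rewrite -ltNge -addrA addrCA ltrDl ltr_wpDl.
  by have := ler_norm M; move: e0; set u := (expR 2)^-1; lra.
Qed.

Lemma residual_g_infty (R : realType) : residual (@g_infty R).
Proof.
have e0 : 0 < expR 2 :> R by exact: expR_gt0.
have ei0 : 0 < (expR 2)^-1 :> R by rewrite invr_gt0.
split.
- by rewrite /g_infty eqxx.
- move=> x y; rewrite le_eqVlt => /predU1P[<- y0|x0 xy].
    rewrite {1}/g_infty eqxx; have [ye|ye] := leP y (expR 2)^-1.
      have [|L L2 ->] := @expRN_ln _ y; first by rewrite y0.
      by rewrite g_infty_expRN// invr_gt0; lra.
    rewrite /g_infty gt_eqF// leNgt ye/= addr_gt0 ?invr_gt0//.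
    by rewrite !mulr_gt0// invr_gt0.
  have y0 := lt_trans x0 xy.
  have [ye|ye] := leP y (expR 2)^-1.
    have [|L L2 yL] := @expRN_ln _ y; first by rewrite y0.
    have [|K K2 xK] := @expRN_ln _ x.
      by rewrite x0 (le_trans _ ye)// ltW.
    rewrite xK yL !g_infty_expRN//.
    have LK : L < K by move: xy; rewrite xK yL ltr_expR ltrN2.
    by rewrite ltf_pV2// posrE; lra.
  rewrite [ltRHS]/g_infty (gt_eqF y0) leNgt ye/=.
  have [xe|xe] := leP x (expR 2)^-1.
    have [|K K2 xK] := @expRN_ln _ x; first by rewrite x0.
    rewrite xK g_infty_expRN//.
    apply: (@le_lt_trans _ _ 2^-1); first by rewrite lef_pV2// posrE; lra.
    have : 1 < expR 2 * y by rewrite -ltr_pdivrMl// mulr1.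
    by lra.
  rewrite /g_infty (gt_eqF x0) leNgt xe/= ltrD2l ltr_pM2l//.
- move=> e ep; exists (expR (- (2 + e^-1))); first exact: expR_gt0.
  have q0 : 0 < e^-1 by rewrite invr_gt0.
  rewrite g_infty_expRN; last by rewrite lerDl ltW.
  by rewrite -[leRHS]invrK lef_pV2 ?posrE ?addr_gt0// lerDr.
- move=> M; exists ((expR 2)^-1 * (4 * `|M| + 2)).
    by rewrite mulr_ge0 ?addr_ge0 ?mulr_ge0// ltW.
  have m0 : 1 < 4 * `|M| + 2 by have := normr_ge0 M; lra.
  have w0 : 0 < (expR 2)^-1 * (4 * `|M| + 2) by rewrite mulr_gt0//; lra.
  rewrite /g_infty (gt_eqF w0).
  have -> : (expR 2)^-1 * (4 * `|M| + 2) <= (expR 2)^-1 = false.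
    by apply/negbTE; rewrite -ltNge ltr_pMr.
  have -> : 4^-1 * expR 2 * ((expR 2)^-1 * (4 * `|M| + 2)) =
            4^-1 * (4 * `|M| + 2) by field; rewrite gt_eqF.
  by have := ler_norm M; lra.
Qed.

(** Precomposing with the retraction [Num.max 0] of the line onto the half-line
    turns [f] into a function that is monotone everywhere. *)
Lemma residual_measurable (R : realType) (f : R -> R) :
  residual f -> measurable_fun (`[0, +oo[ : set R) f.
Proof.
case=> _ fi _ _.
have mf : measurable_fun (`[0, +oo[ : set R) (fun x => f (Num.max 0 x)).
  apply: nondecreasing_measurable => // x y xy.
  have : Num.max 0 x <= Num.max 0 y by rewrite ge_max !le_max lexx xy orbT.
  by rewrite le_eqVlt => /predU1P[->//|/fi h]; rewrite ltW// h// le_max lexx.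
apply: eq_measurable_fun mf => x.
by rewrite inE/= in_itv/= andbT => /max_idPr ->.
Qed.

(** * Regular variation *)

Lemma RV0Z (R : realType) (f : R -> R) (c rho : R) :
  0 < c -> residual f ->
  (forall lambda, 0 < lambda ->
     f (lambda * x) / f x @[x --> 0^'+] --> lambda `^ rho) ->
  RV0 (fun x => c * f x) rho.
Proof.
move=> c0 resf flim; split.
- exact: residual_measurable (residualZ c0 resf).
- exists 1; first exact: ltr01.
  move=> x /andP[x0 _]; have [f0 fi _ _] := residualZ c0 resf.
  by rewrite -[ltLHS]f0 fi.
- move=> lambda l0; apply: cvg_trans (flim _ l0).
  apply: near_eq_cvg; near=> x.
  by rewrite -mulf_div divff ?mul1r// gt_eqF.
Unshelve. all: by end_near. Qed.

(** [ln (lambda * x) = ln lambda + ln x], where [ln x] dominates near [0]. *)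
Lemma cvg_ln_ratio (R : realType) (lambda : R) : 0 < lambda ->
  ln (lambda * x) / ln x @[x --> 0^'+] --> (1 : R).
Proof.
move=> l0.
have lnVx : (ln x)^-1 @[x --> (0:R)^'+] --> (0 : R).
  apply/ltr0_cvgV0; last exact: lnNy.
  near=> x.
  have x1 : x < 1 by near: x; exact: nbhs_right_lt.
  by rewrite ln_lt0// x1 andbT.
have : ln lambda * (ln x)^-1 + 1 @[x --> (0:R)^'+] --> ln lambda * 0 + 1.
  by apply: cvgD; [exact: cvgMl_tmp|exact: cvg_cst].
rewrite mulr0 add0r; apply: cvg_trans; apply: near_eq_cvg; near=> x.
have x0 : 0 < x by [].
have x1 : x < 1 by near: x; exact: nbhs_right_lt.
rewrite lnM ?posrE// mulrDl divff// lt_eqF//.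
by rewrite ln_lt0// x0.
Unshelve. all: by end_near. Qed.

Lemma near0_small (R : realType) (lambda : R) : 0 < lambda ->
  \forall x \near (0:R)^'+, 0 < lambda * x <= (expR 2)^-1.
Proof.
move=> l0; near=> x; apply/andP; split; first by rewrite mulr_gt0.
rewrite mulrC -ler_pdivlMr//; near: x; apply: nbhs_right_ltW.
by rewrite divr_gt0// invr_gt0 expR_gt0.
Unshelve. all: by end_near. Qed.

Lemma RV0_Phi_et (R : realType) (rho1 : R -> R) (kappa : R) :
  0 < rho1 kappa -> RV0 (fun a => Phi_et rho1 a kappa) 1.
Proof.
move=> C0; apply: RV0Z => //; first exact: residual_g_minfty.
move=> lambda l0; rewrite powRr1 ?(ltW l0)//.
have : lambda * (ln (lambda * x) / ln x) @[x --> (0:R)^'+] --> lambda * 1.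
  by apply: cvgMl_tmp; exact: cvg_ln_ratio.
rewrite mulr1; apply: cvg_trans; apply: near_eq_cvg; near=> x.
have x0 : 0 < x by [].
have /andP[lx0 lxe] : 0 < lambda * x <= (expR 2)^-1.
  by near: x; exact: near0_small.
have /andP[_ xe] : 0 < 1 * x <= (expR 2)^-1.
  by near: x; exact: near0_small.
rewrite mul1r in xe.
rewrite /g_minfty !gt_eqF// lxe xe.
have ln0 : ln x != 0.
  rewrite lt_eqF// ln_lt0// x0 (le_lt_trans xe)// invf_lt1 ?expR_gt0//.
  by rewrite expR_gt1.
by field; rewrite ln0 gt_eqF.
Unshelve. all: by end_near. Qed.

Lemma RV0_Phi_ln (R : realType) (rho2 : R -> R) (kappa : R) :
  0 < rho2 kappa -> RV0 (fun a => Phi_ln rho2 a kappa) 0.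
Proof.
move=> C0; apply: RV0Z => //; first exact: residual_g_infty.
move=> lambda l0; rewrite powRr0.
have : (ln (lambda * x) / ln x)^-1 @[x --> (0:R)^'+] --> (1 : R)^-1.
  by apply: cvgV; [exact: oner_neq0|exact: cvg_ln_ratio].
rewrite invr1; apply: cvg_trans; apply: near_eq_cvg; near=> x.
have x0 : 0 < x by [].
have /andP[lx0 lxe] : 0 < lambda * x <= (expR 2)^-1.
  by near: x; exact: near0_small.
have /andP[_ xe] : 0 < 1 * x <= (expR 2)^-1.
  by near: x; exact: near0_small.
rewrite mul1r in xe.
rewrite /g_infty !gt_eqF// lxe xe.
by rewrite invrN invrK mulrNN invf_div mulrC.
Unshelve. all: by end_near. Qed.

(** * Explicit parametrizations of the graph of [phi] near 0 *)

(** [et_curve] and [ln_curve] are the values of [phi] at [expR (- (2 * L))] for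
    the two residual functions; [2 <= L] corresponds to the first branches in
    the definitions of [g_minfty] and [g_infty]. *)
Definition et_curve (R : realType) (C L : R) : R := (C * (L * expR (- L))) ^+ 2.

Definition ln_curve (R : realType) (C L : R) : R := (C * L^-1) ^+ 2.

Lemma et_curveE (R : realType) (rho1 : R -> R) (kappa L : R) : 2 <= L ->
  et_curve (rho1 kappa) L = phi kappa (Phi_et rho1) (expR (- (2 * L))).
Proof. by move=> L2; rewrite phi_expR /Phi_et g_minfty_expRN. Qed.

Lemma ln_curveE (R : realType) (rho2 : R -> R) (kappa L : R) : 2 <= L ->
  ln_curve (rho2 kappa) L = phi kappa (Phi_ln rho2) (expR (- (2 * L))).
Proof. by move=> L2; rewrite phi_expR /Phi_ln g_infty_expRN. Qed.

Lemma is_derive_et_curve (R : realType) (C L : R) :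
  is_derive L 1 (et_curve C)
    (expR (- (2 * L)) * (2 * C ^+ 2 * (L - L ^+ 2))).
Proof.
have dL : is_derive L 1 ((cst C * (id * (expR \o -%R))) ^+ 2)
    (expR (- (2 * L)) * (2 * C ^+ 2 * (L - L ^+ 2))).
  apply: is_derive_eq; rewrite /GRing.scale/= !fctE/=.
  rewrite -mulrN expRM_natl; set e := expR (- L); ring.
exact: dL.
Qed.

Lemma is_derive_ln_curve (R : realType) (C L : R) : L != 0 ->
  is_derive L 1 (ln_curve C) (- (2 * C ^+ 2 / L ^+ 3)).
Proof.
move=> L0.
have dL : is_derive L 1 ((cst C * (fun x => x^-1)) ^+ 2)
    (- (2 * C ^+ 2 / L ^+ 3)).
  have dV : is_derive L 1 (fun x : R => x^-1) (- L ^- 2).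
    apply: DeriveDef; first exact: derivableV.
    by rewrite deriveV// derive_id /GRing.scale/= mulr1.
  apply: is_derive_eq; rewrite /GRing.scale/= !fctE/=.
  by field.
exact: dL.
Qed.

(** * Comparison functions *)

Lemma is_derive_cube (R : realType) (a L : R) :
  is_derive L 1 (fun x => a * x ^+ 3) (3 * a * L ^+ 2).
Proof.
have dL : is_derive L 1 (cst a * id ^+ 3) (3 * a * L ^+ 2).
  by apply: is_derive_eq; rewrite /GRing.scale/= !fctE/=; ring.
exact: dL.
Qed.

Lemma is_derive_expRM (R : realType) (a b L : R) :
  is_derive L 1 (fun x => a * expR (b * x)) (a * b * expR (b * L)).
Proof.
have dL : is_derive L 1 (cst a * (expR \o (cst b * id))) (a * b * expR (b * L)).
  by apply: is_derive_eq; rewrite /GRing.scale/= !fctE/=; ring.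
exact: dL.
Qed.

Lemma expR_sub_half_small (R : realType) (e c : R) : 0 < e ->
  \forall L \near +oo, expR (c - L / 2) < e.
Proof.
move=> e0; near=> L.
rewrite -[ltRHS](lnK e0) ltr_expR.
have : 2 * (c - ln e) < L by near: L; apply: nbhs_pinfty_gt; rewrite num_real.
lra.
Unshelve. all: by end_near. Qed.

Lemma ln_le_linear (R : realType) (e x : R) : 0 < e -> 0 < x ->
  ln x <= e * x - ln e.
Proof.
move=> e0 x0; rewrite lerBrDl -lnM ?posrE//.
exact/ltW/ln_sublinear/mulr_gt0.
Qed.

(** * Almost linear rate *)

Section almost_linear_rate.
Context (R : realType) (rho1 : R -> R) (kappa delta : R).
Context (C0 : 0 < rho1 kappa) (d0 : 0 < delta).
Let C := rho1 kappa.
Let H (L : R) := - spade kappa (Phi_et rho1) delta (et_curve C L).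

Lemma residual_phi_et : residual (phi kappa (Phi_et rho1)).
Proof. exact/residual_phi/residualZ/residual_g_minfty. Qed.

(** The derivative of [H] is [2 * C ^+ 2 * (L ^+ 2 - L)], which lies between
    [C ^+ 2 * L ^+ 2] and [2 * C ^+ 2 * L ^+ 2] for [2 <= L]. *)
Lemma spade_et_bounds : exists c K : R, [/\ 0 < c, 0 < K &
  forall L : R, 2 <= L -> c * L ^+ 3 - K <= H L <= K * L ^+ 3].
Proof.
have [K0 K00 HK] : exists2 K, 0 < K & forall L : R, 2 <= L ->
    C ^+ 2 / 3 * L ^+ 3 - K <= H L <= 2 * C ^+ 2 / 3 * L ^+ 3 + K.
  apply: (spade_curve_bounds residual_phi_et d0 (@et_curveE _ _ _)
    (fun L _ => is_derive_et_curve _ L) (fun L _ => is_derive_cube _ L)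
    (fun L _ => is_derive_cube _ L)) => L L2.
  rewrite (mulrA (expR _)) -expRD addrN expR0 mul1r.
  have C2 : 0 < C ^+ 2 by rewrite exprn_gt0.
  by rewrite -/C; apply/andP; split; nra.
have C20 : 0 < C ^+ 2 by rewrite exprn_gt0.
exists (C ^+ 2 / 3), (2 * C ^+ 2 / 3 + K0); split.
- by rewrite divr_gt0.
- by rewrite addr_gt0// divr_gt0// mulr_gt0.
move=> L L2; have /andP[HL1 HL2] := HK _ L2.
have L3 : 1 <= L ^+ 3 by rewrite exprn_ege1//; lra.
have K0L : K0 * 1 <= K0 * L ^+ 3 by rewrite ler_pM2l.
have CL : 0 <= C ^+ 2 * L ^+ 3 by rewrite mulr_ge0 ?sqr_ge0//; lra.
by apply/andP; split; lra.
Qed.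

Lemma spade_et_cvg : H L @[L --> +oo] --> +oo.
Proof.
have [c [K [c0 K0 HK]]] := spade_et_bounds.
apply/cvgryPge => A; near=> L.
have L2 : 2 <= L by near: L; apply: nbhs_pinfty_ge; rewrite num_real.
have LA : (`|A| + K) / c <= L by near: L; apply: nbhs_pinfty_ge; rewrite num_real.
have /andP[+ _] := HK _ L2; apply: le_trans.
rewrite ler_pdivrMr// mulrC in LA.
have L3 : L <= L ^+ 3.
  by rewrite exprS ler_peMr ?exprn_ege1//; lra.
rewrite lerBrDr; apply: (@le_trans _ _ (c * L)); last by rewrite ler_pM2l.
by apply: le_trans LA; rewrite lerD2r ler_norm.
Unshelve. all: by end_near. Qed.

Lemma near_spade_inv_et (P : R -> R -> Prop) :
  (\forall L \near +oo, P (H L) (et_curve C L)) ->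
  \forall s \near +oo, P s (spade_inv kappa (Phi_et rho1) delta (- s)).
Proof.
exact: (near_spade_inv residual_phi_et d0 (@et_curveE _ _ _)
  (fun L _ => is_derive_et_curve _ L) spade_et_cvg).
Qed.

Lemma sqrt_et_curve (L : R) : 0 < L -> Num.sqrt (et_curve C L) = expR (ln C + ln L - L).
Proof.
move=> L0; rewrite sqrtr_sqr gtr0_norm; last by rewrite !mulr_gt0 ?expR_gt0.
by rewrite !expRD !lnK// mulrA.
Qed.

(** With [s = H L], of order at most [L ^+ 3], the logarithm of the quotient is
    [- L] plus at most [1 + 3 * r] times [ln L] and a constant; the logarithmic
    term is absorbed by half of [L]. *)
Lemma spade_inv_et_superpoly (r : R) : 0 < r ->
  little_o_pinfty
    (fun s => Num.sqrt (spade_inv kappa (Phi_et rho1) delta (- s)))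
    (fun s => s `^ (- r)).
Proof.
move=> r0; apply/cvgr0Pnorm_lt => e e0.
apply: (near_spade_inv_et (P := fun s t => `|Num.sqrt t / s `^ (- r)| < e)).
have [c [K [c0 K0 HK]]] := spade_et_bounds.
(* b is the slope for which a * ln L <= L / 2 up to a constant. *)
pose a := 1 + 3 * r; pose b := (2 * a)^-1.
have a0 : 0 < a by rewrite addr_gt0// mulr_gt0.
have b0 : 0 < b by rewrite invr_gt0 mulr_gt0.
have ab : a * b = 2^-1 by rewrite /b; field; rewrite gt_eqF.
near=> L.
have L2 : 2 <= L by near: L; apply: nbhs_pinfty_ge; rewrite num_real.
have L0 : 0 < L by lra.
have H0 : 0 < H L.
  by near: L; have /cvgryPgt := spade_et_cvg; exact.
have /andP[_ HL] := HK _ L2.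
rewrite sqrt_et_curve// powRN invrK ger0_norm; last first.
  by rewrite mulr_ge0 ?expR_ge0 ?powR_ge0.
apply: (@le_lt_trans _ _ (expR (ln C + r * ln K - a * ln b - L / 2))); last first.
  by near: L; exact: expR_sub_half_small.
rewrite /powR gt_eqF// -expRD ler_expR.
have lnH : ln (H L) <= ln K + 3 * ln L.
  have -> : 3 * ln L = ln (L ^+ 3) by rewrite lnXn// mulr_natl.
  by rewrite -lnM ?posrE ?exprn_gt0// ler_ln// posrE mulr_gt0 ?exprn_gt0.
have lnL := ln_le_linear b0 L0.
have : r * ln (H L) <= r * (ln K + 3 * ln L) by rewrite ler_pM2l.
have : a * ln L <= a * (b * L - ln b) by rewrite ler_pM2l.
rewrite mulrBr mulrA ab /a.
move: (ln (H L)) (ln L) (ln K) (ln b) (ln C) => x1 x2 x3 x4 x5.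
by lra.
Unshelve. all: by end_near. Qed.

(** With [s = H L], of order at least [L ^+ 3], the logarithm of the quotient is
    at most [L - r * c * L ^+ 3] up to a constant, and the cubic term wins. *)
Lemma spade_inv_et_subexp (r : R) : 0 < r ->
  little_o_pinfty (fun s => expR (- (r * s)))
    (fun s => Num.sqrt (spade_inv kappa (Phi_et rho1) delta (- s))).
Proof.
move=> r0; apply/cvgr0Pnorm_lt => e e0.
apply: (near_spade_inv_et (P := fun s t => `|expR (- (r * s)) / Num.sqrt t| < e)).
have [c [K [c0 K0 HK]]] := spade_et_bounds.
near=> L.
have L2 : 2 <= L by near: L; apply: nbhs_pinfty_ge; rewrite num_real.
have L0 : 0 < L by lra.
(* This makes r * c * L ^+ 3 at least 2 * L. *)
have Lrc : 2 / (r * c) <= L by near: L; apply: nbhs_pinfty_ge; rewrite num_real.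
have /andP[HL _] := HK _ L2.
rewrite sqrt_et_curve// -expRB ger0_norm ?expR_ge0//.
apply: (@le_lt_trans _ _ (expR (r * K - ln C - L / 2))); last first.
  by near: L; exact: expR_sub_half_small.
rewrite ler_expR.
have lnL : 0 <= ln L by rewrite ln_ge0//; lra.
have rH : r * (c * L ^+ 3 - K) <= r * H L by rewrite ler_pM2l.
have rc0 : 0 < r * c by rewrite mulr_gt0.
have rcL : 2 * L <= r * (c * L ^+ 3).
  have L1 : 1 <= L by lra.
  rewrite ler_pdivrMr// mulrC in Lrc.
  have : 2 * L <= r * c * L * L by rewrite ler_pM2r.
  have : r * c * L ^+ 2 <= r * c * L ^+ 3.
    by rewrite ler_pM2l// exprS ler_peMl// sqr_ge0.
  by lra.
rewrite mulrBr in rH.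
move: (ln L) (ln C) lnL => x1 x2 x10.
by lra.
Unshelve. all: by end_near. Qed.

End almost_linear_rate.

(** * Logarithmic rate *)

Section logarithmic_rate.
Context (R : realType) (rho2 : R -> R) (kappa delta : R).
Context (C0 : 0 < rho2 kappa) (d0 : 0 < delta).
Let C := rho2 kappa.
Let H (L : R) := - spade kappa (Phi_ln rho2) delta (ln_curve C L).

Lemma residual_phi_ln : residual (phi kappa (Phi_ln rho2)).
Proof. exact/residual_phi/residualZ/residual_g_infty. Qed.

Lemma is_derive_ln_curve_ge2 (L : R) : 2 <= L ->
  is_derive L 1 (ln_curve C) (- (2 * C ^+ 2 / L ^+ 3)).
Proof. by move=> L2; apply: is_derive_ln_curve; rewrite gt_eqF//; lra. Qed.

(** The derivative of [H] is [2 * C ^+ 2 * expR (2 * L) / L ^+ 3]. The factor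
    [1 / L ^+ 3] is at most [1 / 8], and at least [expR (- L) / 27] because
    [expR L = expR (L / 3) ^+ 3]; giving up one exponential in the lower bound
    only changes the constant in front of the logarithm. *)
Lemma spade_ln_bounds : exists c K : R, [/\ 0 < c, 0 < K &
  forall L : R, 2 <= L -> c * expR L - K <= H L <= K * expR (2 * L)].
Proof.
have C20 : 0 < C ^+ 2 by rewrite exprn_gt0.
have [K0 K00 HK] : exists2 K, 0 < K & forall L : R, 2 <= L ->
    2 * C ^+ 2 / 27 * expR (1 * L) - K <= H L <= C ^+ 2 / 8 * expR (2 * L) + K.
  apply: (spade_curve_bounds residual_phi_ln d0 (@ln_curveE _ _ _)
    is_derive_ln_curve_ge2 (fun L _ => is_derive_expRM _ _ L)
    (fun L _ => is_derive_expRM _ _ L)) => L L2.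
  have L0 : 0 < L by lra.
  have L30 : 0 < L ^+ 3 by rewrite exprn_gt0.
  have e0 : 0 < expR (2 * L) by exact: expR_gt0.
  rewrite mul1r mulrN opprK mulr1.
  have -> : expR (2 * L) * (2 * C ^+ 2 / L ^+ 3) =
            2 * C ^+ 2 * expR (2 * L) / L ^+ 3 by field; rewrite gt_eqF.
  apply/andP; split.
    rewrite ler_pdivlMr//.
    have -> : expR (2 * L) = expR L * expR L by rewrite -expRD; congr expR; lra.
    have L3e : L ^+ 3 / 27 <= expR L.
      have -> : expR L = expR (L / 3) ^+ 3.
        by rewrite -expRM_natl; congr expR; field.
      have -> : L ^+ 3 / 27 = (L / 3) ^+ 3 by field.
      rewrite lerXn2r ?nnegrE ?expR_ge0 ?divr_ge0 ?(ltW L0)//.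
      by have := expR_ge1Dx (L / 3); lra.
    have : 2 * C ^+ 2 * expR L * (L ^+ 3 / 27) <= 2 * C ^+ 2 * expR L * expR L.
      by rewrite ler_pM2l// !mulr_gt0// expR_gt0.
    by lra.
  rewrite ler_pdivrMr//.
  have L38 : 8 <= L ^+ 3.
    have -> : 8 = 2 ^+ 3 :> R by ring.
    by rewrite lerXn2r ?nnegrE// ltW.
  have : C ^+ 2 * expR (2 * L) * 8 <= C ^+ 2 * expR (2 * L) * L ^+ 3.
    by rewrite ler_pM2l// mulr_gt0.
  by lra.
exists (2 * C ^+ 2 / 27), (C ^+ 2 / 8 + K0); split.
- by rewrite divr_gt0// mulr_gt0.
- by rewrite addr_gt0// divr_gt0.
move=> L L2; have /andP[HL1 HL2] := HK _ L2; rewrite mul1r in HL1.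
have e1 : 1 <= expR (2 * L) by rewrite ltW// expR_gt1; lra.
have K0L : K0 * 1 <= K0 * expR (2 * L) by rewrite ler_pM2l.
by apply/andP; split; lra.
Qed.

Lemma spade_ln_cvg : H L @[L --> +oo] --> +oo.
Proof.
have [c [K [c0 K0 HK]]] := spade_ln_bounds.
apply/cvgryPge => A; near=> L.
have L2 : 2 <= L by near: L; apply: nbhs_pinfty_ge; rewrite num_real.
have LA : (A + K) / c <= L by near: L; apply: nbhs_pinfty_ge; rewrite num_real.
have /andP[+ _] := HK _ L2; apply: le_trans.
rewrite ler_pdivrMr// mulrC in LA.
rewrite lerBrDr; apply: le_trans LA _; rewrite ler_pM2l//.
by have := expR_ge1Dx L; lra.
Unshelve. all: by end_near. Qed.

(** With [s = H L], the bounds on [H] give [L / 2 <= ln s <= 3 * L] for large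
    [L], while the square root to be estimated is [C / L]. *)
Lemma spade_inv_ln_log : exists eta1 eta2 N : R,
  [/\ 0 < eta1, 0 < eta2 & forall s : R, N <= s ->
    eta1 * (ln s)^-1
      <= Num.sqrt (spade_inv kappa (Phi_ln rho2) delta (- s))
      <= eta2 * (ln s)^-1].
Proof.
suff [N [_ HN]] : \forall s \near +oo, C / 2 * (ln s)^-1
    <= Num.sqrt (spade_inv kappa (Phi_ln rho2) delta (- s))
    <= 3 * C * (ln s)^-1.
  exists (C / 2), (3 * C), (N + 1); split.
  - by rewrite divr_gt0.
  - by rewrite mulr_gt0.
  - by move=> s Ns; apply: HN; lra.
apply: (near_spade_inv (P := fun s t => C / 2 * (ln s)^-1 <= Num.sqrt t
    <= 3 * C * (ln s)^-1) residual_phi_ln d0 (@ln_curveE _ _ _)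
    is_derive_ln_curve_ge2 spade_ln_cvg).
have [c [K [c0 K0 HK]]] := spade_ln_bounds.
near=> L.
have L2 : 2 <= L by near: L; apply: nbhs_pinfty_ge; rewrite num_real.
have L0 : 0 < L by lra.
have LK : ln K <= L by near: L; apply: nbhs_pinfty_ge; rewrite num_real.
have Lc : 2 * (ln 2 - ln c) <= L.
  by near: L; apply: nbhs_pinfty_ge; rewrite num_real.
have H1 : 1 < H L by near: L; have /cvgryPgt := spade_ln_cvg; exact.
have HLK : K < H L by near: L; have /cvgryPgt := spade_ln_cvg; exact.
have /andP[HL1 HL2] := HK _ L2; rewrite -/(H L).
have H0 : 0 < H L by rewrite (lt_trans _ H1).
have lnH0 : 0 < ln (H L) by rewrite ln_gt0.
(* Taking L >= ln K absorbs the constant factor of the upper bound. *)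
have lnH3 : ln (H L) <= 3 * L.
  apply: (@le_trans _ _ (ln (K * expR (2 * L)))).
    by rewrite ler_ln ?posrE ?mulr_gt0 ?expR_gt0.
  by rewrite lnM ?posrE ?expR_gt0// expRK; lra.
(* H L >= K turns the lower bound into c * expR L <= 2 * H L, and Lc absorbs
   the remaining constants. *)
have lnH2 : L <= 2 * ln (H L).
  have : ln (c * expR L) <= ln (2 * H L).
    by rewrite ler_ln ?posrE ?mulr_gt0 ?expR_gt0//; lra.
  by rewrite !lnM ?posrE ?expR_gt0// expRK; lra.
rewrite sqrtr_sqr gtr0_norm; last by rewrite mulr_gt0// invr_gt0.
apply/andP; split.
  rewrite -mulrA ler_pM2l// -invfM lef_pV2// posrE mulr_gt0//.
rewrite -mulrA mulrCA ler_pM2l// -[leRHS]invrK invfM invrK.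
rewrite lef_pV2 ?posrE ?mulr_gt0 ?invr_gt0//.
by rewrite mulrC ler_pdivrMr// mulrC.
Unshelve. all: by end_near. Qed.

End logarithmic_rate.

Theorem proposition6p9 (R : realType) (rho1 rho2 : R -> R)
  (rho1_gt0 : forall b : R, 0 < b -> 0 < rho1 b)
  (rho2_gt0 : forall b : R, 0 < b -> 0 < rho2 b)
  (rho1_nd : forall b c : R, 0 < b -> b <= c -> rho1 b <= rho1 c)
  (rho2_nd : forall b c : R, 0 < b -> b <= c -> rho2 b <= rho2 c)
  (rho1_bound : error_bound (@V1 R) (@g_minfty R) rho1)
  (rho2_bound : error_bound (@V2 R) (@g_infty R) rho2)
  (kappa : R) (kappa_gt0 : 0 < kappa)
  (delta1 delta2 : R)
  (delta1_dom : phi_dom kappa (Phi_et rho1) delta1)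
  (delta2_dom : phi_dom kappa (Phi_ln rho2) delta2) :
  [/\
    RV0 (fun a => Phi_et rho1 a kappa) 1 /\
    RV0 (fun a => Phi_ln rho2 a kappa) 0,

    spade kappa (Phi_et rho1) delta1 t @[t --> 0^'+] --> -oo /\
    spade kappa (Phi_ln rho2) delta2 t @[t --> 0^'+] --> -oo,

    forall r : R, 0 < r ->
      little_o_pinfty
        (fun s => Num.sqrt (spade_inv kappa (Phi_et rho1) delta1 (- s)))
        (fun s => s `^ (- r)) /\
      little_o_pinfty
        (fun s => expR (- (r * s)))
        (fun s => Num.sqrt (spade_inv kappa (Phi_et rho1) delta1 (- s))) &

    exists eta1 eta2 N : R,
      [/\ 0 < eta1, 0 < eta2 & forall s : R, N <= s ->
        eta1 * (ln s)^-1
          <= Num.sqrt (spade_inv kappa (Phi_ln rho2) delta2 (- s))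
          <= eta2 * (ln s)^-1]].
Proof.
have C1 := rho1_gt0 _ kappa_gt0; have C2 := rho2_gt0 _ kappa_gt0.
have [d1 _] := delta1_dom; have [d2 _] := delta2_dom.
split.
- by split; [exact: RV0_Phi_et|exact: RV0_Phi_ln].
- split.
  + apply: (spade_cvgNy _ d1 _ (spade_et_cvg C1 d1)).
      exact: residual_phi_et.
    near=> L.
    have L0 : 0 < L by near: L; apply: nbhs_pinfty_gt; rewrite num_real.
    by rewrite exprn_gt0// !mulr_gt0// expR_gt0.
  + apply: (spade_cvgNy _ d2 _ (spade_ln_cvg C2 d2)).
      exact: residual_phi_ln.
    near=> L.
    have L0 : 0 < L by near: L; apply: nbhs_pinfty_gt; rewrite num_real.
    by rewrite exprn_gt0// mulr_gt0// invr_gt0.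
- by move=> r r0; split; [exact: spade_inv_et_superpoly|exact: spade_inv_et_subexp].
- exact: spade_inv_ln_log.
Unshelve. all: by end_near. Qed.
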